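(* Let $F\subset\mathbb{R}^n$ be a fractal curve, let $\varphi_1,\varphi_2\in F$ with $\varphi_1<\varphi_2$, and let $p$ and $g$ be two $F$-continuous real-valued functions defined on $\{\theta\in F:\varphi_1<\theta<\varphi_2\}$. Let $\theta_0\in F$ with $\varphi_1<\theta_0<\varphi_2$. Then for each $y_0\in\mathbb{R}$ there exists a unique solution $y=\psi(\theta)$, defined at least in a neighborhood of $\theta_0$ in $F$, of the $\alpha$-order fractal differential equation $$D_F^{\alpha}y(\theta)+p(\theta)\,y(\theta)=g(\theta)$$ with the initial condition $y(\theta_0)=y_0$.
   Context: Fractal curve: a set $F\subset\mathbb{R}^n$ with a continuous bijective parametrization $\mathbf{w}:[a_0,b_0]\to F$. Points of $F$ are ordered by parameter: $\theta<\theta'$ means $\mathbf{w}^{-1}(\theta)<\mathbf{w}^{-1}(\theta')$. A neighborhood of $\theta_0$ is understood as an open sub-arc $\{\theta\in F:\theta_1<\theta<\theta_2\}$ containing $\theta_0$. Mass function: fix $1\le\alpha\le n$. For $[a,b]\subset[a_0,b_0]$, $$\gamma^{\alpha}(F,a,b)=\lim_{\delta\to0}\ \inf_{|P|\le\delta}\ \sum_{i=0}^{m-1}\frac{|\mathbf{w}(t_{i+1})-\mathbf{w}(t_i)|^{\alpha}}{\Gamma(\alpha+1)},$$ the infimum being over subdivisions $P=\{a=t_0<\dots<t_m=b\}$ with $|P|=\max_i(t_{i+1}-t_i)\le\delta$, and $|\cdot|$ the Euclidean norm. Staircase function: fix $p_0\in[a_0,b_0]$; $S_F^{\alpha}(u)=\gamma^{\alpha}(F,p_0,u)$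 if $u\ge p_0$ and $S_F^{\alpha}(u)=-\gamma^{\alpha}(F,u,p_0)$ if $u<p_0$. Put $J(\theta)=S_F^{\alpha}(\mathbf{w}^{-1}(\theta))$ for $\theta\in F$. Standing convention: $S_F^{\alpha}$ is finite and strictly increasing on $[a_0,b_0]$, so that the difference quotients below make sense. $F$-limit and $F$-continuity: $F\text{-}\lim_{\theta'\to\theta}f(\theta')=\ell$ means that for every $\varepsilon>0$ there is $\delta>0$ such that $|f(\theta')-\ell|<\varepsilon$ for all $\theta'$ in the domain of $f$ (a subset of $F$) with $0<|\theta'-\theta|<\delta$; $f$ is $F$-continuous if $F\text{-}\lim_{\theta'\to\theta}f(\theta')=f(\theta)$ at each point $\theta$ of its domain. $F^{\alpha}$-derivative: $D_F^{\alpha}f(\theta)=F\text{-}\lim_{\theta'\to\theta}\dfrac{f(\theta')-f(\theta)}{J(\theta')-J(\theta)}$ if this limit exists. A solution on a neighborhood $U$ of $\theta_0$ is a function $\psi:U\to\mathbb{R}$ that has an $F^{\alpha}$-derivative at each point of $U$ and satisfies the equation at each point of $U$. Uniqueness means that two solutions on the same neighborhood of $\theta_0$ with the same value at $\theta_0$ coincide there. *)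

(* Defs.v *)
From HB Require Import structures.
From mathcomp Require Import all_boot all_order all_algebra.
From mathcomp Require Import all_classical all_reals all_analysis.

Set Implicit Arguments.
Unset Strict Implicit.
Unset Printing Implicit Defensive.

Import Order.TTheory GRing.Theory Num.Theory.
Import numFieldNormedType.Exports.

Local Open Scope classical_set_scope.
Local Open Scope ring_scope.

(* The library norm on 'rV[R]_n is the sup norm, hence this definition. *)
Definition enorm (R : realType) (n : nat) (x : 'rV[R]_n) : R :=
  Num.sqrt (\sum_(i < n) x ord0 i ^+ 2).

(* Euler's Gamma function, for x > 0. *)
Definition Gamma (R : realType) (x : R) : R :=
  \int[lebesgue_measure]_(t in `]0, +oo[) (t `^ (x - 1) * expR (- t)).

(* Only the values of fc_param on [fc_lo, fc_hi] are meaningful.  The topology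
   on 'rV[R]_n is the product topology, which is the Euclidean one. *)
Record fractal_curve (R : realType) (n : nat) := FractalCurve {
  fc_set : set 'rV[R]_n;
  fc_lo : R;
  fc_hi : R;
  fc_param : R -> 'rV[R]_n;
  fc_param_continuous : {within `[fc_lo, fc_hi], continuous fc_param};
  fc_param_bij : set_bij `[fc_lo, fc_hi] fc_set fc_param }.

(* The inverse parametrization, meaningful on fc_set F. *)
Definition fc_inv (R : realType) (n : nat) (F : fractal_curve R n) :
    'rV[R]_n -> R :=
  'pinv_(fun=> fc_lo F) `[fc_lo F, fc_hi F]%classic (fc_param F).

Definition fc_lt (R : realType) (n : nat) (F : fractal_curve R n)
    (th th' : 'rV[R]_n) : Prop :=
  fc_inv F th < fc_inv F th'.

Definition open_arc (R : realType) (n : nat) (F : fractal_curve R n)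
    (th1 th2 : 'rV[R]_n) : set 'rV[R]_n :=
  [set th | [/\ fc_set F th, fc_lt F th1 th & fc_lt F th th2]].

Definition arc_nbhs (R : realType) (n : nat) (F : fractal_curve R n)
    (th0 : 'rV[R]_n) (U : set 'rV[R]_n) : Prop :=
  exists th1 th2, [/\ fc_set F th1, fc_set F th2,
    U = open_arc F th1 th2 & U th0].

(* A subdivision a = t_0 < ... < t_m = b is encoded, following itv_partition,
   by the sequence s = [:: t_1; ...; t_m], so that t_i = nth b (a :: s) i and
   m = size s; for a = b the only subdivision is s = [::]. *)
Definition mesh (R : realType) (a b : R) (s : seq R) : R :=
  \big[Num.max/0]_(i < size s) (nth b (a :: s) i.+1 - nth b (a :: s) i).

Definition mass_sum (R : realType) (n : nat) (F : fractal_curve R n)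
    (alpha a b : R) (s : seq R) : R :=
  \sum_(i < size s)
    enorm (fc_param F (nth b (a :: s) i.+1) - fc_param F (nth b (a :: s) i))
      `^ alpha / Gamma (alpha + 1).

Definition coarse_mass (R : realType) (n : nat) (F : fractal_curve R n)
    (alpha a b delta : R) : \bar R :=
  ereal_inf [set (mass_sum F alpha a b s)%:E |
    s in [set s | itv_partition a b s /\ mesh a b s <= delta]].

Definition mass (R : realType) (n : nat) (F : fractal_curve R n)
    (alpha a b : R) : \bar R :=
  lim (coarse_mass F alpha a b delta @[delta --> 0^'+]).

Definition staircase (R : realType) (n : nat) (F : fractal_curve R n)
    (alpha p0 u : R) : \bar R :=
  if p0 <= u then mass F alpha p0 u else (- mass F alpha u p0)%E.

Definition staircase_J (R : realType) (n : nat) (F : fractal_curve R n)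
    (alpha p0 : R) (th : 'rV[R]_n) : R :=
  fine (staircase F alpha p0 (fc_inv F th)).

(* F-limit at th of a function f with domain D; functions defined on a part D
   of the curve are total functions considered on D only. *)
Definition is_F_lim (R : realType) (n : nat) (D : set 'rV[R]_n)
    (f : 'rV[R]_n -> R) (th : 'rV[R]_n) (l : R) : Prop :=
  forall eps : R, 0 < eps -> exists2 delta : R, 0 < delta &
    forall th', D th' -> 0 < enorm (th' - th) < delta -> `|f th' - l| < eps.

Definition F_continuous (R : realType) (n : nat) (D : set 'rV[R]_n)
    (f : 'rV[R]_n -> R) : Prop :=
  forall th, D th -> is_F_lim D f th (f th).

Definition is_F_derivative (R : realType) (n : nat) (F : fractal_curve R n)
    (alpha p0 : R) (D : set 'rV[R]_n) (f : 'rV[R]_n -> R)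
    (th : 'rV[R]_n) (l : R) : Prop :=
  is_F_lim D (fun th' => (f th' - f th) /
    (staircase_J F alpha p0 th' - staircase_J F alpha p0 th)) th l.

(* psi : U -> R solves D_F^alpha y + p y = g at each point of U. *)
Definition is_solution (R : realType) (n : nat) (F : fractal_curve R n)
    (alpha p0 : R) (p g : 'rV[R]_n -> R) (U : set 'rV[R]_n)
    (psi : 'rV[R]_n -> R) : Prop :=
  forall th, U th -> exists2 l : R,
    is_F_derivative F alpha p0 U psi th l & l + p th * psi th = g th.

(* Main.v *)
Require Import Defs.
From HB Require Import structures.
From mathcomp Require Import all_boot all_order all_algebra.
From mathcomp Require Import all_classical all_reals all_analysis.
From mathcomp Require Import ring lra.

Set Implicit Arguments.
Unset Strict Implicit.
Unset Printing Implicit Defensive.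

Import Order.TTheory GRing.Theory Num.Theory.
Import numFieldNormedType.Exports.

(** The curve is straightened by its staircase function, and the fractal
    equation becomes the ordinary equation y' + P y = G on a real interval.

    The point that needs work is that the staircase S is continuous; it is
    assumed to be only finite and strictly increasing.  The mass is additive
    ([mass_additive]): partitions of two adjacent intervals concatenate, and
    conversely a partition of the union can be cut at the common endpoint b at
    the cost of two chords with an end at b, which are short when the mesh is
    small because the parametrization is continuous.  The total mass M is then
    finite, and it is the limit of the coarse masses; pick a mesh d whose coarse
    mass is at least M - e.  For an interval [x, y] of length at most d, the
    coarse mass of the curve is at most the mass before x, plus that of the
    single chord from x to y, plus the mass after y.  Comparing with M, the mass
    of [x, y] is at most that of the chord plus e ([mass_le_chord]).  As the
    mass of [x, y] is S y - S x, the function S is continuous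
    ([staircase_continuous]).

    Hence S is a homeomorphism between parameter intervals, and
    W := w o S^-1 parametrizes the curve by its mass.  Since W is continuous and
    injective on a segment, which is compact, its inverse J is continuous on the
    curve.  Therefore F-limits along an open arc are ordinary limits of the
    function composed with W ([F_lim_chartP]), F-continuity of p and g is
    continuity of p o W and g o W, and, because J (W s) = s, the
    F^alpha-derivative of f at th is the derivative of f o W at J th
    ([F_derivative_chart]).

    What remains is the scalar linear equation with continuous coefficients,
    solved and shown to have a unique solution by means of the integrating
    factor exp A, where A is an antiderivative of P ([linear_ode_exists],
    [linear_ode_unique]). *)

Local Open Scope classical_set_scope.
Local Open Scope ring_scope.

(** * The Euclidean norm on row vectors *)

Lemma enorm_continuous (R : realType) (n : nat) : continuous (@enorm R n).
Proof.
move=> x; apply: continuous_comp; last exact: sqrt_continuous.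
apply: (@cvg_big _ _ _ _ _ _ _ (nbhs x)) => [|i _].
  exact: add_continuous.
apply: (@continuous_cvg _ _ _ _ _ (fun M : 'rV[R]_n => M ord0 i) (fun r => r ^+ 2)).
  exact: exprn_continuous.
exact: coord_continuous.
Qed.

Lemma enorm0 (R : realType) (n : nat) : enorm (0 : 'rV[R]_n) = 0.
Proof.
by rewrite /enorm big1 ?sqrtr0// => i _; rewrite mxE expr0n.
Qed.

Lemma enormN (R : realType) (n : nat) (x : 'rV[R]_n) : enorm (- x) = enorm x.
Proof. by rewrite /enorm; under eq_bigr do rewrite mxE sqrrN. Qed.

Lemma enorm_ge0 (R : realType) (n : nat) (x : 'rV[R]_n) : 0 <= enorm x.
Proof. exact: sqrtr_ge0. Qed.

(** Makes closeness in the Euclidean norm imply closeness in the topology, which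
    is defined coordinatewise. *)
Lemma normr_coord_le_enorm (R : realType) (n : nat) (x : 'rV[R]_n) i :
  `|x ord0 i| <= enorm x.
Proof.
rewrite -sqrtr_sqr ler_sqrt ?sumr_ge0// => [|j _]; last exact: sqr_ge0.
by rewrite (bigD1 i)//= lerDl sumr_ge0// => j _; exact: sqr_ge0.
Qed.

Lemma enorm_gt0 (R : realType) (n : nat) (x : 'rV[R]_n) : x != 0 -> 0 < enorm x.
Proof.
move=> x0; rewrite lt_def enorm_ge0 andbT; apply: contraNneq x0 => e0.
apply/eqP/rowP => i; rewrite mxE; apply/normr0_eq0/eqP.
by rewrite eq_le normr_ge0 andbT -e0 normr_coord_le_enorm.
Qed.

(** * The mass of an arc and the staircase function *)

Lemma ereal_eq_fineB (R : realType) (x y m : \bar R) : x \is a fin_num ->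
  y \is a fin_num -> y = (x + m)%E -> m = (fine y - fine x)%:E.
Proof.
move: x y m => [x| |] [y| |] [m| |]//= _ _ [->].
by congr (_%:E); ring.
Qed.

Section mass.
Variables (R : realType) (n : nat) (F : fractal_curve R n) (alpha : R).
Hypothesis alpha_ge1 : 1 <= alpha.

Definition chord_mass (x y : R) : R :=
  enorm (fc_param F y - fc_param F x) `^ alpha / Gamma (alpha + 1).

Lemma Gamma_ge0 x : 0 <= Gamma x :> R.
Proof.
by apply: Rintegral_ge0 => t _; rewrite mulr_ge0 ?powR_ge0 ?expR_ge0.
Qed.

Lemma chord_mass_ge0 x y : 0 <= chord_mass x y.
Proof. by rewrite divr_ge0 ?powR_ge0 ?Gamma_ge0. Qed.

Lemma mass_sum_nil a b : mass_sum F alpha a b [::] = 0.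
Proof. by rewrite /mass_sum big_ord0. Qed.

Lemma mass_sum_cons a b y s :
  mass_sum F alpha a b (y :: s) = chord_mass a y + mass_sum F alpha y b s.
Proof. by rewrite /mass_sum big_ord_recl. Qed.

Lemma mass_sum1 a b : mass_sum F alpha a b [:: b] = chord_mass a b.
Proof. by rewrite mass_sum_cons mass_sum_nil addr0. Qed.

Lemma mesh_nil (a b : R) : mesh a b [::] = 0.
Proof. by rewrite /mesh big_ord0. Qed.

Lemma mesh_cons (a b y : R) s :
  mesh a b (y :: s) = Num.max (y - a) (mesh y b s).
Proof. by rewrite /mesh big_ord_recl. Qed.

Lemma itv_partition_consE (a b y : R) s :
  itv_partition a b (y :: s) <-> a < y /\ itv_partition y b s.
Proof.
rewrite /itv_partition /=; split; first by move=> [/andP[-> ->] ->].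
by move=> [-> [-> ->]].
Qed.

Lemma mass_sum_ge0 a b s : 0 <= mass_sum F alpha a b s.
Proof.
elim: s a => [|y s IH] a; first by rewrite mass_sum_nil.
by rewrite mass_sum_cons addr_ge0 ?chord_mass_ge0.
Qed.

Lemma mass_sum_cat a b c s t : itv_partition a b s ->
  mass_sum F alpha a c (s ++ t) = mass_sum F alpha a b s + mass_sum F alpha b c t.
Proof.
elim: s a => [|y s IH] a.
  by move=> /itv_partition_nil ->; rewrite mass_sum_nil add0r.
move=> /itv_partition_consE[_ /IH sE].
by rewrite cat_cons !mass_sum_cons sE addrA.
Qed.

Lemma mesh_cat (a b c d : R) s t : itv_partition a b s ->
  mesh a b s <= d -> mesh b c t <= d -> mesh a c (s ++ t) <= d.
Proof.
elim: s a => [|y s IH] a; first by move=> /itv_partition_nil ->.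
move=> /itv_partition_consE[_ sp]; rewrite cat_cons !mesh_cons !ge_max.
by move=> /andP[-> sd] td; exact: IH.
Qed.

(** Cutting a partition of [a, c] at b.  Only the step ]x, y[ that contains b
    changes: its chord is replaced by the two chords from x to b and from b to
    y, which may be larger in total than the chord from x to y.  Both have b
    as an end and length at most the mesh in parameter, so that continuity at b
    alone bounds the excess. *)
Lemma itv_partition_split (a b c d e : R) s : 0 <= d -> a <= b <= c ->
  (forall x, a <= x <= c -> `|x - b| <= d ->
     chord_mass x b <= e /\ chord_mass b x <= e) ->
  0 <= e ->
  itv_partition a c s -> mesh a c s <= d ->
  exists s1 s2, [/\ itv_partition a b s1 /\ mesh a b s1 <= d,
    itv_partition b c s2 /\ mesh b c s2 <= d &
    mass_sum F alpha a b s1 + mass_sum F alpha b c s2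
      <= mass_sum F alpha a c s + (e + e)].
Proof.
move=> d0 + + e0; elim: s a => [|y s IH] a /andP[ab bc] He.
  move=> /itv_partition_nil ac _; have ba : b = a by lra.
  exists [::], [::]; rewrite -ac ba !mass_sum_nil !mesh_nil.
  by do ?split=> //=; rewrite ?add0r ?addr_ge0.
move=> /itv_partition_consE[ay sp]; rewrite mesh_cons ge_max => /andP[yad sd].
have yc := itv_partition_le sp.
move: ab; rewrite le_eqVlt => /predU1P[ba|ab].
  exists [::], (y :: s); rewrite mesh_nil mass_sum_nil; subst b; split => //.
  - by split; [exact/itv_partition_consE|rewrite mesh_cons ge_max yad].
  - by rewrite add0r lerDl addr_ge0.
have [yb|yb] := leP y b.
  have [||s1 [s2 [[p1 m1] [p2 m2] le12]]] := IH y _ _ sp sd.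
  - by rewrite yb.
  - move=> x /andP[yx xc] xb; apply: He => //.
    by rewrite xc (le_trans (ltW ay) yx).
  exists (y :: s1), s2; split.
  - by rewrite itv_partition_consE mesh_cons ge_max ay yad.
  - by [].
  - by rewrite !mass_sum_cons; lra.
exists [:: b], (y :: s); split.
- split; first exact: itv_partition1.
  by rewrite mesh_cons mesh_nil ge_max d0 andbT; lra.
- by rewrite itv_partition_consE mesh_cons ge_max yb sd andbT; split=> //; lra.
- rewrite mass_sum1 !mass_sum_cons.
  have [] := He a; rewrite ?lexx ?(le_trans (ltW ab))//.
    by rewrite distrC ger0_norm; lra.
  move=> h1 _; have [] := He y; rewrite ?yc ?(ltW ay)//.
    by rewrite ger0_norm; lra.
  move=> _; have := chord_mass_ge0 a y; move: h1.
  move: (chord_mass a b) (chord_mass b y) (chord_mass a y).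
  by move: (mass_sum F alpha y c s) => *; lra.
Qed.

Lemma coarse_mass_ge0 a b d : (0 <= coarse_mass F alpha a b d)%E.
Proof.
by apply: le_ereal_inf_tmp => _ [s _ <-]; rewrite lee_fin mass_sum_ge0.
Qed.

Lemma coarse_mass_nonincreasing a b :
  {homo coarse_mass F alpha a b : d e / d <= e >-> (e <= d)%E}.
Proof.
move=> d e de; apply: ereal_inf_le_tmp => _ [s [ps ms] <-].
by exists s => //; split=> //; exact: le_trans de.
Qed.

Lemma coarse_mass_cvg a b :
  coarse_mass F alpha a b d @[d --> 0^'+] --> mass F alpha a b.
Proof.
apply: nonincreasing_at_right_is_cvge.
by near=> x => d e _ _ de; exact: coarse_mass_nonincreasing.
Unshelve. all: by end_near. Qed.

Lemma coarse_mass_le_mass a b d : 0 < d ->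
  (coarse_mass F alpha a b d <= mass F alpha a b)%E.
Proof.
move=> d0; apply: lime_ge; first exact: coarse_mass_cvg.
near=> e; apply: coarse_mass_nonincreasing; apply/ltW.
by near: e; exact: nbhs_right_lt.
Unshelve. all: by end_near. Qed.

Lemma mass_le_of_coarse a b x :
  (forall d, 0 < d -> (coarse_mass F alpha a b d <= x)%E) ->
  (mass F alpha a b <= x)%E.
Proof.
move=> H; apply: lime_le; first exact: coarse_mass_cvg.
by near=> e; apply: H; near: e; exact: nbhs_right_gt.
Unshelve. all: by end_near. Qed.

Lemma mass_ge0 a b : (0 <= mass F alpha a b)%E.
Proof. exact: le_trans (coarse_mass_ge0 _ _ _) (@coarse_mass_le_mass _ _ 1 _). Qed.

Lemma massxx a : mass F alpha a a = 0%E.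
Proof.
apply/eqP; rewrite eq_le mass_ge0 andbT; apply: mass_le_of_coarse => d d0.
apply: ereal_inf_lbound; exists [::]; last by rewrite mass_sum_nil.
by rewrite /= mesh_nil; split; [split=> /=|exact: ltW].
Qed.

(** The one-step partition is admissible on an interval shorter than the mesh. *)
Lemma coarse_mass_chord a b d : 0 < d -> a <= b -> b - a <= d ->
  (coarse_mass F alpha a b d <= (chord_mass a b)%:E)%E.
Proof.
move=> d0; rewrite le_eqVlt => /predU1P[-> _|ab abd].
  apply: (le_trans (coarse_mass_le_mass _ _ d0)).
  by rewrite massxx lee_fin chord_mass_ge0.
apply: ereal_inf_lbound; exists [:: b].
  split; first exact: itv_partition1.
  by rewrite mesh_cons mesh_nil ge_max abd ltW.
by rewrite mass_sum1.
Qed.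

Lemma coarse_mass_subadditive a b c d :
  (coarse_mass F alpha a c d
     <= coarse_mass F alpha a b d + coarse_mass F alpha b c d)%E.
Proof.
have H s t : itv_partition a b s -> mesh a b s <= d ->
    itv_partition b c t -> mesh b c t <= d ->
    (coarse_mass F alpha a c d
       <= (mass_sum F alpha a b s)%:E + (mass_sum F alpha b c t)%:E)%E.
  move=> ps ms pt mt; apply: ereal_inf_lbound.
  exists (s ++ t); last by rewrite (mass_sum_cat _ _ ps).
  by split; [exact: itv_partition_cat ps pt|exact: mesh_cat ps ms mt].
have H1 s : itv_partition a b s -> mesh a b s <= d ->
    (coarse_mass F alpha a c d
       <= (mass_sum F alpha a b s)%:E + coarse_mass F alpha b c d)%E.
  move=> ps ms; rewrite -leeBlDl//; apply: le_ereal_inf_tmp => _ [t [pt mt] <-].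
  by rewrite leeBlDl//; exact: H.
have := coarse_mass_ge0 b c d; move: H1.
case: (coarse_mass F alpha b c d) => [r| |] H1 // _; last first.
  by rewrite addey ?leey// gt_eqF// (lt_le_trans _ (coarse_mass_ge0 _ _ _))// ltNyr.
rewrite -leeBlDr//; apply: le_ereal_inf_tmp => _ [s [ps ms] <-].
by rewrite leeBlDr//; exact: H1.
Qed.

(** Since alpha >= 1, the power r `^ alpha is at most r for r in [0, 1], so
    continuity of the parametrization at b is enough. *)
Lemma chord_mass_small b (e : R) : 0 < e -> b \in `[fc_lo F, fc_hi F] ->
  exists2 d : R, 0 < d & forall x, x \in `[fc_lo F, fc_hi F] -> `|x - b| <= d ->
    chord_mass x b <= e /\ chord_mass b x <= e.
Proof.
move=> e0 bI; pose c := (Gamma (alpha + 1) : R)^-1.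
have c0 : 0 <= c by rewrite invr_ge0 Gamma_ge0.
have c1 : 0 < c + 1 by rewrite ltr_wpDl.
pose eta := Num.min 1 (e / (c + 1)).
have eta0 : 0 < eta by rewrite lt_min ltr01 divr_gt0.
have powle r : 0 <= r -> r <= eta -> r `^ alpha / Gamma (alpha + 1) <= e.
  move=> r0; rewrite le_min => /andP[r1 re].
  have rar : r `^ alpha <= r.
    move: r0; rewrite le_eqVlt => /predU1P[<-|r0].
      by rewrite powR0// gt_eqF// (lt_le_trans ltr01).
    by rewrite ge1r_powR// r0.
  apply: (le_trans (ler_wpM2r c0 (le_trans rar re))).
  by rewrite mulrAC ler_pdivrMr// ler_wpM2l ?ltW// ltrDl.
have /subspace_continuousP /(_ _ bI) wc := @fc_param_continuous _ _ F.
have : enorm (fc_param F x - fc_param F b)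
    @[x --> within `[fc_lo F, fc_hi F] (nbhs b)] --> enorm (0 : 'rV[R]_n).
  apply: continuous_cvg; first exact: enorm_continuous.
  by rewrite -(subrr (fc_param F b)); apply: cvgB => //; exact: cvg_cst.
rewrite enorm0 => /cvgrPdist_le /(_ _ eta0); rewrite near_withinE.
move=> /nbhs_ballP[d /= d0 dP]; exists (d / 2); first by rewrite divr_gt0.
move=> x xI xb; have : ball b d x.
  by rewrite /ball/= distrC (le_lt_trans xb)// gtr_pMr// invf_lt1// ltr1n.
move=> /dP /(_ xI); rewrite sub0r normrN ger0_norm ?enorm_ge0// => xe.
rewrite /chord_mass; split; apply: powle; rewrite ?enorm_ge0//.
by rewrite -opprB enormN.
Qed.

(** Concatenation of partitions gives one inequality.  For the other, a
    partition of [a, c] that is fine enough is cut at b with an excess at most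
    e; the mesh has to shrink with e, so the bound compares coarse masses at a
    fixed mesh with the mass itself. *)
Lemma mass_additive a b c : a \in `[fc_lo F, fc_hi F] ->
  c \in `[fc_lo F, fc_hi F] -> a <= b <= c ->
  mass F alpha a c = (mass F alpha a b + mass F alpha b c)%E.
Proof.
rewrite !in_itv/= => /andP[la ah] /andP[lc ch] /andP[ab bc].
have cvg_ab_bc : (coarse_mass F alpha a b d + coarse_mass F alpha b c d)%E
    @[d --> 0^'+] --> (mass F alpha a b + mass F alpha b c)%E.
  apply: cvgeD; [|exact: coarse_mass_cvg..].
  by rewrite ge0_adde_def// inE mass_ge0.
apply/eqP; rewrite eq_le; apply/andP; split.
  apply: mass_le_of_coarse => d d0; apply: (le_trans (coarse_mass_subadditive a b c d)).
  by apply: leeD; exact: coarse_mass_le_mass.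
rewrite -(cvg_lim _ cvg_ab_bc)//; apply: lime_le; first exact: cvgP cvg_ab_bc.
near=> d; apply/lee_addgt0Pr => e e0.
have d0 : 0 < d by near: d; exact: nbhs_right_gt.
have e20 : 0 < e / 2 by rewrite divr_gt0.
have [|d' d'0 small] := @chord_mass_small b (e / 2) e20.
  by rewrite in_itv/=; lra.
pose d1 := Num.min d d'; have d10 : 0 < d1 by rewrite lt_min d0.
apply: (@le_trans _ _ (coarse_mass F alpha a c d1 + e%:E)); last first.
  by rewrite leeD2r// coarse_mass_le_mass.
rewrite -leeBlDr//; apply: le_ereal_inf_tmp => _ [s [ps ms] <-].
rewrite leeBlDr//.
have [||s1 [s2 [[p1 m1] [p2 m2] le12]]] :=
    @itv_partition_split a b c d1 (e / 2) s (ltW d10) _ _ (ltW e20) ps ms.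
- by rewrite ab.
- move=> x /andP[ax xc] xb; apply: small; first by rewrite in_itv/=; lra.
  by rewrite (le_trans xb)// ge_min lexx orbT.
rewrite -splitr in le12; rewrite -EFinD.
apply: le_trans (_ : _ <= (mass_sum F alpha a b s1 + mass_sum F alpha b c s2)%:E)%E _;
  last by rewrite lee_fin.
have d1d : d1 <= d by rewrite ge_min lexx.
by rewrite EFinD; apply: leeD; apply: ereal_inf_lbound;
  [exists s1|exists s2] => //; split=> //; exact: le_trans d1d.
Unshelve. all: by end_near. Qed.

(** Fix a mesh d at which the coarse mass of the whole curve is within e of its
    mass.  If y - x <= d, then
      mass lo hi <= coarse_mass lo hi d + e
                 <= mass lo x + chord_mass x y + mass y hi + e,
    and additivity cancels the masses of the two outer pieces, which are
    finite. *)
Lemma mass_le_chord (e : R) : 0 < e ->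
  mass F alpha (fc_lo F) (fc_hi F) \is a fin_num ->
  exists2 d : R, 0 < d & forall x y, x \in `[fc_lo F, fc_hi F] ->
    y \in `[fc_lo F, fc_hi F] -> x <= y -> y - x <= d ->
    (mass F alpha x y <= (chord_mass x y + e)%:E)%E.
Proof.
move=> e0 mfin.
(* Otherwise the limit of the coarse masses would be at most mass - e. *)
have [d d0 dP] : exists2 d : R, 0 < d & (mass F alpha (fc_lo F) (fc_hi F)
    <= coarse_mass F alpha (fc_lo F) (fc_hi F) d + e%:E)%E.
  apply: contrapT => nex.
  have : (mass F alpha (fc_lo F) (fc_hi F)
      <= mass F alpha (fc_lo F) (fc_hi F) - e%:E)%E.
    apply: mass_le_of_coarse => d d0; rewrite leeBrDr//.
    by have [//|/ltW dP] := leP; exfalso; apply: nex; exists d.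
  by rewrite leeBrDr// -(fineK mfin) -EFinD lee_fin gerDl leNgt e0.
exists d => // x y xI yI xy yxd.
have [/andP[lx xh] /andP[ly yh]] : fc_lo F <= x <= fc_hi F /\ fc_lo F <= y <= fc_hi F.
  by move: xI yI; rewrite !in_itv.
have lI : fc_lo F \in `[fc_lo F, fc_hi F] by rewrite in_itv/= lexx (le_trans lx).
have hI : fc_hi F \in `[fc_lo F, fc_hi F] by rewrite in_itv/= lexx (le_trans lx).
have split_all : mass F alpha (fc_lo F) (fc_hi F) =
    (mass F alpha (fc_lo F) x + (mass F alpha x y + mass F alpha y (fc_hi F)))%E.
  rewrite (mass_additive (b := x) lI hI) ?lx//.
  by rewrite (mass_additive (b := y) xI hI) ?xy.
have : (mass F alpha (fc_lo F) (fc_hi F) <= mass F alpha (fc_lo F) x +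
    ((chord_mass x y)%:E + mass F alpha y (fc_hi F)) + e%:E)%E.
  apply: (le_trans dP); rewrite leeD2r//.
  apply: (le_trans (coarse_mass_subadditive _ x _ _)).
  apply: leeD; first exact: coarse_mass_le_mass.
  apply: (le_trans (coarse_mass_subadditive _ y _ _)).
  by apply: leeD; [exact: coarse_mass_chord|exact: coarse_mass_le_mass].
move: mfin; rewrite split_all.
move: (mass_ge0 (fc_lo F) x) (mass_ge0 x y) (mass_ge0 y (fc_hi F)).
case: (mass F alpha (fc_lo F) x) => [r1| |]//; case: (mass F alpha x y) => [r2| |]//;
case: (mass F alpha y (fc_hi F)) => [r3| |]//= _ _ _ _.
by rewrite -!EFinD !lee_fin; lra.
Qed.

Section staircase.
Variable p0 : R.
Hypothesis p0I : p0 \in `[fc_lo F, fc_hi F].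
Hypothesis S_fin : {in `[fc_lo F, fc_hi F],
  forall u : R, staircase F alpha p0 u \is a fin_num}.

(** In the mixed and the negative cases the mass of a piece is subtracted from
    itself, which is legitimate because the staircase is finite. *)
Lemma staircaseD x y : x \in `[fc_lo F, fc_hi F] -> y \in `[fc_lo F, fc_hi F] ->
  x <= y -> (staircase F alpha p0 y = staircase F alpha p0 x + mass F alpha x y)%E.
Proof.
move=> xI yI xy; have Sx := S_fin xI; have Sy := S_fin yI; move: Sx Sy.
rewrite /staircase; have [px|xp] := leP p0 x.
  by rewrite (le_trans px xy) (mass_additive (b := x) p0I yI) ?px.
have [py|yp] := leP p0 y.
  rewrite (mass_additive (b := p0) xI yI) ?py ?(ltW xp)//.
  move: (mass F alpha x p0) (mass F alpha p0 y) => [r1| |] [r2| |]//= _ _.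
  by congr (_%:E); ring.
rewrite (mass_additive (b := y) xI p0I) ?xy ?ltW//.
move: (mass F alpha x y) (mass F alpha y p0) => [r1| |] [r2| |]//= _ _.
by congr (_%:E); ring.
Qed.

Lemma staircase_continuous :
  {within `[fc_lo F, fc_hi F], continuous (fine \o staircase F alpha p0)}.
Proof.
set f := fine \o staircase F alpha p0.
have lh : fc_lo F <= fc_hi F.
  by move: p0I; rewrite in_itv/= => /andP[]; exact: le_trans.
have lI : fc_lo F \in `[fc_lo F, fc_hi F] by rewrite bound_itvE.
have hI : fc_hi F \in `[fc_lo F, fc_hi F] by rewrite bound_itvE.
have massE x y : x \in `[fc_lo F, fc_hi F] -> y \in `[fc_lo F, fc_hi F] ->
    x <= y -> mass F alpha x y = (f y - f x)%:E.
  move=> xI yI xy.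
  exact: ereal_eq_fineB (S_fin xI) (S_fin yI) (staircaseD xI yI xy).
clearbody f; apply/subspace_continuousP => b bI; apply/cvgrPdist_le => e e0.
have e20 : 0 < e / 2 by rewrite divr_gt0.
have [|d d0 dP] := mass_le_chord e20; first by rewrite massE.
have [d' d'0 d'P] := chord_mass_small e20 bI.
rewrite near_withinE; apply/nbhs_ballP; exists (Num.min d d') => /=.
  by rewrite lt_min d0.
move=> x; rewrite /ball/= distrC lt_min => /andP[/ltW xd /ltW xd'] xI.
have [xbe bxe] := d'P x xI xd'.
have [xb|/ltW bx] := leP x b.
  rewrite ler0_norm ?subr_le0// opprB in xd.
  have fxb : 0 <= f b - f x by rewrite -lee_fin -massE// mass_ge0.
  rewrite ger0_norm// -lee_fin -massE// (le_trans (dP _ _ xI bI xb xd))//.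
  by rewrite lee_fin [leRHS]splitr; exact: lerD xbe (lexx _).
rewrite ger0_norm ?subr_ge0// in xd.
have fbx : 0 <= f x - f b by rewrite -lee_fin -massE// mass_ge0.
rewrite distrC ger0_norm// -lee_fin -massE// (le_trans (dP _ _ bI xI bx xd))//.
by rewrite lee_fin [leRHS]splitr; exact: lerD bxe (lexx _).
Qed.

End staircase.

End mass.

(** * First-order linear differential equations *)

Section linear_ode.
Variable R : realType.
Implicit Types (f p g : R -> R) (a b s t : R).

(** Continuity of A up to the endpoints is what allows a second antiderivative,
    that of g exp A, to be taken on the same segment. *)
Lemma antiderivative f a b : a < b -> {within `[a, b], continuous f} ->
  exists2 A : R -> R, {within `[a, b], continuous A} &
    forall s, s \in `]a, b[ -> is_derive s 1 A (f s).
Proof.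
move=> ab fc.
have fi := continuous_compact_integrable (@segment_compact _ a b) fc.
exists (parameterized_integral lebesgue_measure a ^~ f) => [|s sab].
  exact: parameterized_integral_continuous (ltW ab) fi.
have /andP[as_ sb] : a < s < b by move: sab; rewrite in_itv.
have [dF F'] := @continuous_FTC1_closed _ f a s b sb fi as_
  (within_continuous_continuous ab fc sab).
by apply: DeriveDef; [exact: dF|rewrite -derive1E; exact: F'].
Qed.

Lemma is_derive_expR_comp (A p : R -> R) s : is_derive s 1 A (p s) ->
  is_derive s 1 (fun t => expR (A t)) (expR (A s) * p s).
Proof. by move=> dA; exact: is_derive1_comp. Qed.

(** Variation of constants: y = exp (- P) (y0 exp (P s0) + int_s0^s g exp P). *)
Lemma linear_ode_exists p g a b s0 (y0 : R) : {within `[a, b], continuous p} ->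
  {within `[a, b], continuous g} -> s0 \in `]a, b[ ->
  exists2 y : R -> R, y s0 = y0 & forall s, s \in `]a, b[ ->
    is_derive s 1 y (g s - p s * y s).
Proof.
move=> pc gc s0I.
have ab : a < b by move: s0I; rewrite in_itv/= => /andP[]; exact: lt_trans.
have [P Pc dP] := antiderivative ab pc.
have gPc : {within `[a, b], continuous (fun s => g s * expR (P s))}.
  move=> s; apply: cvgM; first exact: gc.
  by apply: continuous_cvg; [exact: continuous_expR|exact: Pc].
have [B _ dB] := antiderivative ab gPc.
exists (fun s => expR (- P s) * (y0 * expR (P s0) + (B s - B s0))) => [|s sI].
  by rewrite subrr addr0 mulrCA -expRD addrC subrr expR0 mulr1.
have dPs := dP s sI; have dBs := dB s sI.
have dNP : is_derive s 1 (fun t => expR (- P t)) (expR (- P s) * - p s).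
  by apply: (@is_derive_expR_comp _ (fun t => - p t)); exact: is_deriveN.
have dB1 : is_derive s 1 (fun t => y0 * expR (P s0) + (B t - B s0))
    (g s * expR (P s)).
  rewrite -[X in is_derive _ _ _ X]add0r; apply: is_deriveD.
  by rewrite -[X in is_derive _ _ _ X]subr0; apply: is_deriveB.
apply: (is_derive_eq (is_deriveM dNP dB1)) => /=.
have -> : expR (- P s) *: (g s * expR (P s)) = g s.
  by rewrite /GRing.scale/= mulrCA -expRD addrC subrr expR0 mulr1.
by rewrite /GRing.scale/=; ring.
Qed.

(** The difference u of two solutions satisfies u' = - p u, hence exp P * u has
    zero derivative, for P an antiderivative of p. *)
Lemma linear_ode_unique p g (y1 y2 : R -> R) a b s0 :
  {within `[a, b], continuous p} -> s0 \in `]a, b[ -> y1 s0 = y2 s0 ->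
  (forall s, s \in `]a, b[ -> is_derive s 1 y1 (g s - p s * y1 s)) ->
  (forall s, s \in `]a, b[ -> is_derive s 1 y2 (g s - p s * y2 s)) ->
  forall s, s \in `]a, b[ -> y1 s = y2 s.
Proof.
move=> pc s0I y12 dy1 dy2 s sI.
have ab : a < b by move: s0I; rewrite in_itv/= => /andP[]; exact: lt_trans.
have [P Pc dP] := antiderivative ab pc.
pose z t := expR (P t) * (y1 t - y2 t).
have dz t : t \in `]a, b[ -> is_derive t 1 z 0.
  move=> tI; have dPt := dP t tI; have d1 := dy1 t tI; have d2 := dy2 t tI.
  have dE : is_derive t 1 (fun t => expR (P t)) (expR (P t) * p t).
    exact: is_derive_expR_comp.
  have d12 : is_derive t 1 (fun t => y1 t - y2 t)
      ((g t - p t * y1 t) - (g t - p t * y2 t)) by apply: is_deriveB.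
  apply: (is_derive_eq (is_deriveM dE d12)) => /=.
  by rewrite /GRing.scale/=; ring.
have z_cst u v : u \in `]a, b[ -> v \in `]a, b[ -> u <= v -> z u = z v.
  move=> uI vI uv.
  have uvI t : t \in `[u, v] -> t \in `]a, b[.
    move: uI vI; rewrite !in_itv/= => /andP[au _] /andP[_ vb] /andP[ut tv].
    by rewrite (lt_le_trans au ut) (le_lt_trans tv vb).
  have zc : {within `[u, v], continuous z}.
    by apply: derivable_within_continuous => t /uvI /dz ?; exact: ex_derive.
  have dz0 t : t \in `]u, v[ -> is_derive t 1 z ((fun=> 0) t).
    by move=> /subset_itv_oo_cc /uvI /dz.
  have [c _] := MVT_segment uv dz0 zc.
  by rewrite mul0r => /eqP; rewrite subr_eq0 => /eqP.
have : z s = z s0 by have [/z_cst->//|/ltW/z_cst->//] := leP s s0.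
rewrite /z y12 subrr mulr0 => /eqP; rewrite mulf_eq0 gt_eqF ?expR_gt0//=.
by rewrite subr_eq0 => /eqP.
Qed.

End linear_ode.

(** * Calculus on an arc in a chart *)

(** The chart W identifies the segment [c, d] with the curve A, with inverse J;
    the derivative on the curve is taken with respect to J.  The open arc D
    corresponds to the interval ]u1, u2[. *)
Section arc_chart.
Variables (R : realType) (n : nat) (A : set 'rV[R]_n).
Variables (W : R -> 'rV[R]_n) (J : 'rV[R]_n -> R) (c d : R).
Hypothesis W_continuous : {within `[c, d], continuous W}.
Hypothesis W_in : forall s, s \in `[c, d] -> A (W s).
Hypothesis WK : {in `[c, d], cancel W J}.
Hypothesis J_in : forall th, A th -> J th \in `[c, d].
Hypothesis JK : forall th, A th -> W (J th) = th.

(** The points of [c, d] at distance at least eta from J th form a compact set;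
    its image by W is closed and misses th, by injectivity of W. *)
Lemma chart_continuous th (eta : R) : A th -> 0 < eta ->
  exists2 del : R, 0 < del & forall th', A th' -> enorm (th' - th) < del ->
    `|J th' - J th| < eta.
Proof.
move=> Ath eta0.
pose K := `[c, d]%classic `&` [set s : R | eta <= `|s - J th|].
have K_closed : closed K.
  apply: closedI; first exact: interval_closed.
  apply: (@preimage_closed _ _ (fun s : R => `|s - J th|) [set r | eta <= r]);
    last exact: closed_ge.
  move=> s _; apply: cvg_norm; apply: cvgB => //; exact: cvg_cst.
have WK_closed : closed (W @` K).
  apply: compact_closed; first exact: norm_hausdorff.
  apply: continuous_compact.
    by apply: continuous_subspaceW W_continuous; exact: subIsetl.
  by apply: subclosed_compact K_closed (@segment_compact _ c d) _; exact: subIsetl.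
have nth : (~` (W @` K)) th.
  move=> [s [sI /= sJ] Ws]; move: sJ.
  by rewrite -Ws WK// subrr normr0 leNgt eta0.
have := open_nbhs_nbhs (conj (closed_openC WK_closed) nth).
move=> /nbhs_ballP[del /= del0 ballP]; exists del => // th' Ath' th'th.
rewrite ltNge; apply/negP => Jge; apply: (ballP th'); last first.
  by exists (J th'); [split=> //=; exact: J_in|exact: JK].
split=> // i j; rewrite /ball/= (ord1 i) distrC.
apply: le_lt_trans th'th.
by have := normr_coord_le_enorm (th' - th) j; rewrite !mxE.
Qed.

Variables (u1 u2 : R) (D : set 'rV[R]_n).
Hypothesis u12 : c <= u1 /\ u2 <= d.
Hypothesis DE : forall th, D th <-> A th /\ J th \in `]u1, u2[.

Lemma chart_in_arc s : s \in `]u1, u2[ -> D (W s) /\ s \in `[c, d].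
Proof.
move=> sI; have sI' : s \in `[c, d].
  by move: sI u12; rewrite !in_itv/= => /andP[? ?] [? ?]; apply/andP; lra.
by split=> //; apply/DE; split; [exact: W_in|rewrite WK].
Qed.

(** Left to right uses continuity of W, right to left that of J; injectivity of
    both exchanges the conditions th' <> th and s <> J th. *)
Lemma F_lim_chartP f th l : D th -> is_F_lim D f th l <->
  forall eps : R, 0 < eps -> exists2 eta : R, 0 < eta & forall s,
    s \in `]u1, u2[ -> 0 < `|s - J th| < eta -> `|f (W s) - l| < eps.
Proof.
move=> /[dup] Dth /DE[Ath JI]; split=> H eps /H[].
  move=> del del0 fdel.
  have : enorm (W s - W (J th))
      @[s --> within `[c, d] (nbhs (J th))] --> enorm (0 : 'rV[R]_n).
    apply: continuous_cvg; first exact: enorm_continuous.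
    rewrite -(subrr (W (J th))); apply: cvgB; last exact: cvg_cst.
    by have /subspace_continuousP /(_ _ (J_in Ath)) := W_continuous.
  rewrite enorm0 => /cvgrPdist_lt /(_ _ del0); rewrite near_withinE.
  move=> /nbhs_ballP[eta /= eta0 etaP]; exists eta => // s sI /andP[sJ0 sJ].
  have [Ds sI'] := chart_in_arc sI; apply: fdel => //.
  rewrite enorm_gt0/=; last first.
    rewrite subr_eq0; apply: contraTneq sJ0 => Wsth.
    by rewrite -(WK sI') Wsth subrr normr0 ltxx.
  have := etaP s; rewrite /ball/= distrC => /(_ sJ sI').
  by rewrite JK// sub0r normrN ger0_norm ?enorm_ge0.
move=> eta eta0 feta; have [del del0 delP] := chart_continuous Ath eta0.
exists del => // th' /DE[Ath' J'I] /andP[n0 ndel].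
have := feta (J th') J'I; rewrite JK//; apply; rewrite delP// andbT.
rewrite normr_gt0 subr_eq0; apply: contraTneq n0 => JJ.
by rewrite -(JK Ath') JJ JK// subrr enorm0 ltxx.
Qed.

Lemma F_continuous_chart f : F_continuous D f -> {in `]u1, u2[, continuous (f \o W)}.
Proof.
move=> fc s sI; have [Ds sI'] := chart_in_arc sI.
apply/cvgrPdist_lt => eps eps0.
have [eta eta0 etaP] := proj1 (F_lim_chartP f (f (W s)) Ds) (fc _ Ds) eps eps0.
rewrite WK// in etaP.
have near_in : \forall t \near s, t \in `]u1, u2[ by exact: near_in_itvoo.
near=> t; have [->|ts] := eqVneq t s; first by rewrite subrr normr0.
rewrite distrC; apply: etaP; first by near: t.
rewrite normr_gt0 subr_eq0 ts/= distrC.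
by near: t; apply/nbhs_ballP; exists eta.
Unshelve. all: by end_near. Qed.

(** As J (W s) = s, the quotient at W s is the usual difference quotient of
    f o W.  The function h is only required to agree with f o W on the interval
    of the arc, since W is meaningful on [c, d] only. *)
Lemma F_derivative_chart f h th l : D th ->
  (forall s, s \in `]u1, u2[ -> f (W s) = h s) ->
  is_F_lim D (fun th' => (f th' - f th) / (J th' - J th)) th l <->
  is_derive (J th) 1 h l.
Proof.
move=> /[dup] Dth /DE[Ath JI] fh.
have fth : f th = h (J th) by rewrite -fh// JK.
have near_in : \forall s \near J th, s \in `]u1, u2[ by exact: near_in_itvoo.
set a := J th in JI fth near_in *.
have dE : is_derive a 1 h l <->
    (t^-1 *: (h (t *: 1 + a) - h a) @[t --> 0^'] --> l).
  split=> [[dh <-]|hl]; first exact: dh.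
  by apply: DeriveDef; [apply/cvg_ex; exists l|exact: cvg_lim hl].
split=> [/(F_lim_chartP _ _ Dth) H|/dE /cvgrPdist_lt H].
  apply/dE/cvgrPdist_lt => eps /H[eta eta0 etaP].
  move: near_in => /nbhs_ballP[r /= r0 rP].
  near=> t; rewrite /GRing.scale/= mulr1 distrC mulrC.
  have tI : t + a \in `]u1, u2[.
    apply: rP; rewrite /ball/= opprD addrCA subrr addr0 normrN.
    by near: t; exact: dnbhs0_lt.
  have := etaP _ tI.
  rewrite fh// fth WK ?(proj2 (chart_in_arc tI))// -/a addrK; apply.
  rewrite normr_gt0; apply/andP; split; near: t; last exact: dnbhs0_lt.
  exact: nbhs_dnbhs_neq.
apply/F_lim_chartP => // eps eps0.
move: (H eps eps0) => /nbhs_ballP[eta /= eta0 etaP]; exists eta => // s sI.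
move=> /andP[sa0 sa]; have := etaP (s - a).
rewrite /ball/= sub0r normrN => /(_ sa); rewrite -normr_gt0 => /(_ sa0).
rewrite /GRing.scale/= mulr1 subrK distrC mulrC fh// fth.
by rewrite WK// (proj2 (chart_in_arc sI)).
Unshelve. all: by end_near. Qed.

End arc_chart.

(** * Parametrization of the curve by its mass *)

Section natural_parametrization.
Variables (R : realType) (n : nat) (F : fractal_curve R n).

Lemma fc_paramK : {in `[fc_lo F, fc_hi F], cancel (fc_param F) (fc_inv F)}.
Proof.
have [_ winj _] := fc_param_bij F => u uI.
by rewrite /fc_inv pinvKV ?inE.
Qed.

Lemma fc_invK th : fc_set F th ->
  fc_inv F th \in `[fc_lo F, fc_hi F] /\ fc_param F (fc_inv F th) = th.
Proof.
have [_ _ wsurj] := fc_param_bij F => /wsurj[u uI <-].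
by rewrite fc_paramK.
Qed.

Lemma fc_set_param u : u \in `[fc_lo F, fc_hi F] -> fc_set F (fc_param F u).
Proof. by have [wfun _ _] := fc_param_bij F => /wfun. Qed.

(** S stands for the real-valued staircase function, of which only continuity
    and strict monotonicity matter here. *)
Variable S : R -> R.
Hypothesis S_continuous : {within `[fc_lo F, fc_hi F], continuous S}.
Hypothesis S_lt : {in `[fc_lo F, fc_hi F] &, {homo S : u v / u < v}}.
Hypothesis lohi : fc_lo F <= fc_hi F.

Definition reparam (s : R) : 'rV[R]_n :=
  fc_param F ('pinv_(fun=> fc_lo F) `[fc_lo F, fc_hi F]%classic S s).

Let V := 'pinv_(fun=> fc_lo F) `[fc_lo F, fc_hi F]%classic S.

Let S_le : {in `[fc_lo F, fc_hi F] &, {mono S : u v / u <= v}}.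
Proof. exact: le_mono_in S_lt. Qed.

Let SK : {in `[fc_lo F, fc_hi F], cancel S V}.
Proof.
move=> u uI; rewrite /V pinvKV ?inE//.
by move=> x y; rewrite !inE; exact: (inc_inj_in S_le).
Qed.

Let V_in s : s \in `[S (fc_lo F), S (fc_hi F)] -> V s \in `[fc_lo F, fc_hi F].
Proof.
have Slohi : S (fc_lo F) <= S (fc_hi F) by rewrite S_le ?bound_itvE.
move=> /(segment_continuous_le_surjective lohi Slohi S_continuous)[u uI <-].
by rewrite SK.
Qed.

Lemma reparam_continuous :
  {within `[S (fc_lo F), S (fc_hi F)], continuous reparam}.
Proof.
have Vc : {within `[S (fc_lo F), S (fc_hi F)], continuous V}.
  exact: segment_can_le_continuous lohi S_continuous SK.
apply/subspace_continuousP => s sI.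
have /subspace_continuousP /(_ _ sI) Vs := Vc.
have /subspace_continuousP /(_ _ (V_in sI)) ws := @fc_param_continuous _ _ F.
apply: cvg_trans ws => P; rewrite /= !nbhs_simpl /within/= => wP.
have : \forall t \near within `[S (fc_lo F), S (fc_hi F)] (nbhs s),
    V t \in `[fc_lo F, fc_hi F] -> P (fc_param F (V t)).
  exact: Vs wP.
by rewrite !near_withinE; apply: filterS => t + tI; apply => //; exact: V_in.
Qed.

Lemma reparam_in s : s \in `[S (fc_lo F), S (fc_hi F)] -> fc_set F (reparam s).
Proof. by move=> /V_in /fc_set_param. Qed.

Lemma reparamK : {in `[S (fc_lo F), S (fc_hi F)], cancel reparam (S \o fc_inv F)}.
Proof.
move=> s sI; rewrite /reparam /= fc_paramK ?V_in//.
exact: (segment_continuous_le_can_sym lohi S_continuous SK).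
Qed.

Lemma reparam_sym th : fc_set F th ->
  S (fc_inv F th) \in `[S (fc_lo F), S (fc_hi F)] /\
  reparam (S (fc_inv F th)) = th.
Proof.
move=> /fc_invK[iI wi]; split; last by rewrite /reparam -/V SK.
by move: iI; rewrite !in_itv/= => iI; rewrite !S_le ?bound_itvE.
Qed.

Lemma fc_ltE th th' : fc_set F th -> fc_set F th' ->
  fc_lt F th th' <-> S (fc_inv F th) < S (fc_inv F th').
Proof.
move=> /fc_invK[iI _] /fc_invK[iI' _].
by rewrite (leW_mono_in S_le).
Qed.

(** The order of the curve is that of S o w^-1, because S is increasing. *)
Lemma open_arcE th1 th2 th : fc_set F th1 -> fc_set F th2 ->
  open_arc F th1 th2 th <->
  fc_set F th /\ S (fc_inv F th) \in `]S (fc_inv F th1), S (fc_inv F th2)[.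
Proof.
move=> th1F th2F; split=> [[thF /fc_ltE l1 /fc_ltE l2]|[thF]].
  by split=> //; rewrite in_itv/= l1 ?l2.
by rewrite in_itv/= => /andP[l1 l2]; split=> //; apply/fc_ltE.
Qed.

End natural_parametrization.

(** * The fractal differential equation *)

Theorem theorem2 (R : realType) (n : nat) (F : fractal_curve R n)
    (alpha p0 : R) (phi1 phi2 th0 : 'rV[R]_n) (p g : 'rV[R]_n -> R)
    (halpha : 1 <= alpha <= n%:R)
    (hp0 : p0 \in `[fc_lo F, fc_hi F])
    (hfin : {in `[fc_lo F, fc_hi F],
       forall u : R, staircase F alpha p0 u \is a fin_num})
    (hincr : {in `[fc_lo F, fc_hi F] &,
       {homo staircase F alpha p0 : u v / u < v >-> (u < v)%E}})
    (hphi1 : fc_set F phi1) (hphi2 : fc_set F phi2)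
    (hphi12 : fc_lt F phi1 phi2)
    (hp : F_continuous (open_arc F phi1 phi2) p)
    (hg : F_continuous (open_arc F phi1 phi2) g)
    (hth0 : open_arc F phi1 phi2 th0) :
  forall y0 : R,
    (exists U psi,
      [/\ arc_nbhs F th0 U, U `<=` open_arc F phi1 phi2,
          is_solution F alpha p0 p g U psi & psi th0 = y0]) /\
    (forall U psi1 psi2,
      arc_nbhs F th0 U -> U `<=` open_arc F phi1 phi2 ->
      is_solution F alpha p0 p g U psi1 -> psi1 th0 = y0 ->
      is_solution F alpha p0 p g U psi2 -> psi2 th0 = y0 ->
      forall th, U th -> psi1 th = psi2 th).
Proof.
have alpha1 : 1 <= alpha by case/andP: halpha.
pose S : R -> R := fine \o staircase F alpha p0.
have Sc : {within `[fc_lo F, fc_hi F], continuous S}.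
  exact: staircase_continuous.
have Slt : {in `[fc_lo F, fc_hi F] &, {homo S : u v / u < v}}.
  move=> u v uI vI uv; have := hincr _ _ uI vI uv.
  by rewrite -(fineK (hfin _ uI)) -(fineK (hfin _ vI)) lte_fin.
have JE : staircase_J F alpha p0 = (fun th => S (fc_inv F th)) by [].
(* From here on only continuity and monotonicity of S are used. *)
clearbody S.
have lohi : fc_lo F <= fc_hi F.
  by move: hp0; rewrite in_itv/= => /andP[]; exact: le_trans.
pose W := reparam F S; pose J th := S (fc_inv F th).
pose c := S (fc_lo F); pose d := S (fc_hi F).
have Wc : {within `[c, d], continuous W} := reparam_continuous Sc Slt lohi.
have W_in s : s \in `[c, d] -> fc_set F (W s).
  exact: reparam_in.
have WK : {in `[c, d], cancel W J} := reparamK Sc Slt lohi.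
have J_in th : fc_set F th -> J th \in `[c, d] by move=> /(reparam_sym Slt)[].
have JK th : fc_set F th -> W (J th) = th by move=> /(reparam_sym Slt)[].
have arcE th1 th2 th : fc_set F th1 -> fc_set F th2 ->
    open_arc F th1 th2 th <-> fc_set F th /\ J th \in `]J th1, J th2[.
  exact: open_arcE.
have J_bounds th1 th2 : fc_set F th1 -> fc_set F th2 -> c <= J th1 /\ J th2 <= d.
  by move=> /J_in + /J_in; rewrite !in_itv/= => /andP[-> _] /andP[_ ->].
have coef_continuous f : F_continuous (open_arc F phi1 phi2) f ->
    {in `]J phi1, J phi2[, continuous (f \o W)}.
  exact: (F_continuous_chart Wc W_in WK J_in JK (J_bounds _ _ hphi1 hphi2)
    (fun th => arcE _ _ th hphi1 hphi2)).
have coef_within f a b : F_continuous (open_arc F phi1 phi2) f ->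
    J phi1 < a -> b < J phi2 -> {within `[a, b], continuous (f \o W)}.
  move=> /coef_continuous fc a1 b2; apply: continuous_in_subspaceT => s.
  rewrite inE/= in_itv/= => /andP[as_ sb]; apply: fc.
  by rewrite in_itv/= (lt_le_trans a1 as_) (le_lt_trans sb b2).
have [th0F J0I] := proj1 (arcE _ _ th0 hphi1 hphi2) hth0.
have derivE th1 th2 th f h l : fc_set F th1 -> fc_set F th2 ->
    open_arc F th1 th2 th ->
    (forall s, s \in `]J th1, J th2[ -> f (W s) = h s) ->
    is_F_derivative F alpha p0 (open_arc F th1 th2) f th l <->
    is_derive (J th) 1 h l.
  move=> th1F th2F thU fh; rewrite /is_F_derivative JE.
  exact: (F_derivative_chart Wc W_in WK J_in JK (J_bounds _ _ th1F th2F)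
    (fun th => arcE _ _ th th1F th2F) _ thU fh).
move=> y0; split.
  (* A shorter arc makes the coefficients continuous on a closed segment. *)
  have [a [b [a1 b2 J0ab]]] : exists a b,
      [/\ J phi1 < a, b < J phi2 & J th0 \in `]a, b[].
    exists ((J phi1 + J th0) / 2), ((J th0 + J phi2) / 2).
    by move: J0I; rewrite !in_itv/= => /andP[? ?]; split; try apply/andP; lra.
  have ab : a < J th0 < b by move: J0ab; rewrite in_itv.
  have [y y_0 dy] := linear_ode_exists y0 (coef_within _ _ _ hp a1 b2)
    (coef_within _ _ _ hg a1 b2) J0ab.
  have [c1 d2] := J_bounds _ _ hphi1 hphi2.
  have aI : a \in `[c, d] by rewrite in_itv/=; lra.
  have bI : b \in `[c, d] by rewrite in_itv/=; lra.
  have aF := W_in _ aI; have bF := W_in _ bI.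
  have UE th : open_arc F (W a) (W b) th <-> fc_set F th /\ J th \in `]a, b[.
    by rewrite -{2}(WK _ aI) -{2}(WK _ bI); exact: arcE.
  exists (open_arc F (W a) (W b)), (y \o J); split => //.
  - by exists (W a), (W b); split=> //; exact/UE.
  - move=> th /UE[thF Jth]; apply/arcE => //; split=> //.
    by move: Jth; rewrite !in_itv/= => /andP[? ?]; lra.
  - move=> th thU; have [thF Jth] := proj1 (UE th) thU.
    exists (g th - p th * (y \o J) th); last by rewrite subrK.
    apply/(derivE _ _ _ _ y) => //.
      move=> s; rewrite !WK// => sI /=; rewrite WK// in_itv/=.
      by move: sI; rewrite in_itv/= => /andP[? ?]; lra.
    by have := dy _ Jth; rewrite /= JK.
move=> U psi1 psi2 [th1 [th2 [th1F th2F -> U0]]] Usub sol1 init1 sol2 init2 th thU.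
have [_ J0U] := proj1 (arcE _ _ th0 th1F th2F) U0.
have [thF JthU] := proj1 (arcE _ _ th th1F th2F) thU.
have sol_deriv psi s : is_solution F alpha p0 p g (open_arc F th1 th2) psi ->
    s \in `]J th1, J th2[ -> is_derive s 1 (psi \o W)
      ((g \o W) s - (p \o W) s * (psi \o W) s).
  move=> sol sI.
  have sI' : s \in `[c, d].
    have [? ?] := J_bounds _ _ th1F th2F.
    by move: sI; rewrite !in_itv/= => /andP[? ?]; lra.
  have WsU : open_arc F th1 th2 (W s).
    by apply/arcE => //; split; [exact: W_in|rewrite WK].
  have [l dl eql] := sol _ WsU.
  have := proj1 (derivE _ _ _ _ (psi \o W) _ th1F th2F WsU (fun _ _ => erefl)) dl.
  by rewrite WK// /= -eql addrK.
(* A segment inside the arc with both points in its interior: p o W need not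
   be continuous up to the endpoints of the arc. *)
have [a [b [a1 b2 J0ab Jthab]]] : exists a b, [/\ J th1 < a, b < J th2,
    J th0 \in `]a, b[ & J th \in `]a, b[].
  exists ((J th1 + Num.min (J th0) (J th)) / 2).
  exists ((Num.max (J th0) (J th) + J th2) / 2).
  move: J0U JthU; rewrite !in_itv/= => /andP[? ?] /andP[? ?].
  by case: (leP (J th0) (J th)) => ?; split; try apply/andP; lra.
have ab_U s : s \in `]a, b[ -> s \in `]J th1, J th2[.
  by rewrite !in_itv/= => /andP[? ?]; lra.
have pc : {within `[a, b], continuous (p \o W)}.
  apply: continuous_in_subspaceT => s; rewrite inE/= in_itv/= => /andP[? ?].
  apply: (coef_continuous _ hp).
  have sI : s \in `]J th1, J th2[ by rewrite in_itv/=; lra.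
  have sI' : s \in `[c, d].
    have [? ?] := J_bounds _ _ th1F th2F.
    by move: sI; rewrite !in_itv/= => /andP[? ?]; lra.
  have WsU : open_arc F th1 th2 (W s).
    by apply/arcE => //; split; [exact: W_in|rewrite WK].
  by have [_] := proj1 (arcE _ _ _ hphi1 hphi2) (Usub _ WsU); rewrite WK.
have y12 : (psi1 \o W) (J th0) = (psi2 \o W) (J th0) by rewrite /= JK// init1.
have := linear_ode_unique pc J0ab y12
  (fun s sI => sol_deriv _ _ sol1 (ab_U s sI))
  (fun s sI => sol_deriv _ _ sol2 (ab_U s sI)) Jthab.
by rewrite /= JK.
Qed.
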